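(* Let $\{\mathcal{A},G,\sigma,\alpha\}$ be a $G$-crossed system with $\mathcal{A}$ an integral domain, $G\neq\{e\}$ an abelian group and $\alpha\equiv 1_{\mathcal{A}}$. Then (i) implies (ii): (i) $I\cap\tilde{\mathcal{A}}\neq\{0\}$ for every non-zero two-sided ideal $I$ in $\mathcal{A}\rtimes_\alpha^\sigma G$. (ii) $\tilde{\mathcal{A}}$ is a maximal commutative subring in $\mathcal{A}\rtimes_\alpha^\sigma G$.
   Context: A $G$-crossed system is a quadruple $\{\mathcal{A},G,\sigma,\alpha\}$ consisting of a unital associative ring $\mathcal{A}$, a group $G$ with unit $e$, a map $\sigma:G\to\mathrm{Aut}(\mathcal{A})$, $x\mapsto\sigma_x$, into the ring automorphisms of $\mathcal{A}$, and a map $\alpha:G\times G\to U(\mathcal{A})$ into the group of invertible elements of $\mathcal{A}$, such that for all $x,y,z\in G$, $a\in\mathcal{A}$: (i) $\sigma_x(\sigma_y(a))=\alpha(x,y)\,\sigma_{xy}(a)\,\alpha(x,y)^{-1}$; (ii) $\alpha(x,y)\,\alpha(xy,z)=\sigma_x(\alpha(y,z))\,\alpha(x,yz)$; (iii) $\alpha(x,e)=\alpha(e,x)=1_{\mathcal{A}}$. The crossed product $\mathcal{A}\rtimes_\alpha^\sigma G$ is the free left $\mathcal{A}$-module with basis $\{\overline{g}: g\in G\}$ (a copy of $G$), made into an associative unital ring by the biadditive multiplication determined by $(a_1\overline{x})(a_2\overline{y})=a_1\sigma_x(a_2)\,\alpha(x,y)\,\overline{xy}$. Its elements are formal sums $\sum_{g\in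 G}a_g\overline{g}$ with $a_g\in\mathcal{A}$, all but finitely many zero. $\tilde{\mathcal{A}}=\{a\overline{e}\mid a\in\mathcal{A}\}$ is the embedded copy of $\mathcal{A}$, and $\mathrm{Comm}(\tilde{\mathcal{A}})=\{b\in\mathcal{A}\rtimes_\alpha^\sigma G\mid ab=ba\ \forall a\in\tilde{\mathcal{A}}\}$. ''$\tilde{\mathcal{A}}$ is maximal commutative in $\mathcal{A}\rtimes_\alpha^\sigma G$'' means $\mathrm{Comm}(\tilde{\mathcal{A}})=\tilde{\mathcal{A}}$. An integral domain is a commutative unital ring with $0\neq1$ in which the product of any two non-zero elements is non-zero. *)

(* Defs.v *)
From HB Require Import structures.
From mathcomp Require Import all_boot all_algebra finmap.
From mathcomp Require Import classical_sets.
From mathcomp Require Import monalg.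

Set Implicit Arguments.
Unset Strict Implicit.
Unset Printing Implicit Defensive.

Import GRing.Theory.
Local Open Scope ring_scope.

(* [crossed_sigma x] ranges over the bijective ring endomorphisms, i.e. Aut(A);
   [G] is written multiplicatively and may be infinite. *)
Record crossed_system (A : unitRingType) (G : groupType) := CrossedSystem {
  crossed_sigma : G -> {rmorphism A -> A};
  crossed_alpha : G -> G -> A;
  crossed_sigma_bij : forall x, bijective (crossed_sigma x);
  crossed_alpha_unit : forall x y, crossed_alpha x y \is a GRing.unit;
  crossed_sigmaM : forall x y a,
    crossed_sigma x (crossed_sigma y a) =
    crossed_alpha x y * crossed_sigma (x * y)%g a * (crossed_alpha x y)^-1;
  crossed_alphaM : forall x y z,
    crossed_alpha x y * crossed_alpha (x * y)%g z =
    crossed_sigma x (crossed_alpha y z) * crossed_alpha x (y * z)%g;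
  crossed_alphax1 : forall x, crossed_alpha x 1%g = 1;
  crossed_alpha1x : forall x, crossed_alpha 1%g x = 1
}.

(* The free left A-module on G; [mkmalgU g a] is the monomial usually written
   a gbar, and [mcoeff g u] (also [u@_g]) is the coefficient of u at gbar.
   The alias depends on the system, so that it can carry the twisted product. *)
Definition crossed_product (A : unitRingType) (G : groupType)
  (S : crossed_system A G) : Type := {malg A[G]}.

HB.instance Definition _ (A : unitRingType) (G : groupType)
  (S : crossed_system A G) := GRing.Lmodule.copy (crossed_product S) {malg A[G]}.

Section CrossedProductRing.
Variables (A : unitRingType) (G : groupType) (S : crossed_system A G).
Local Notation sigma := (crossed_sigma S).
Local Notation alpha := (crossed_alpha S).
Implicit Types (u v w : {malg A[G]}) (a b c : A) (x y z : G).

Definition crossed_one : {malg A[G]} := mkmalgU 1%g 1.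

Definition crossed_mul u v : {malg A[G]} :=
  \sum_(x <- msupp u) \sum_(y <- msupp v)
    mkmalgU (x * y)%g (u@_x * sigma x v@_y * alpha x y).

Lemma crossed_mulEw u v (d1 d2 : {fset G}) :
  (msupp u `<=` d1)%fset -> (msupp v `<=` d2)%fset ->
  crossed_mul u v = \sum_(x <- d1) \sum_(y <- d2)
    mkmalgU (x * y)%g (u@_x * sigma x v@_y * alpha x y).
Proof.
move=> le1 le2; rewrite /crossed_mul (big_fset_incl _ le1) /=; last first.
  move=> x _ /mcoeff_outdom ->.
  by rewrite big1 // => y _; rewrite !mul0r monalgU0.
apply: eq_bigr => x _; rewrite (big_fset_incl _ le2) //=.
by move=> y _ /mcoeff_outdom ->; rewrite rmorph0 mulr0 mul0r monalgU0.
Qed.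

Lemma crossed_mulDl : left_distributive crossed_mul +%R.
Proof.
move=> u v w; pose d := (msupp u `|` msupp v)%fset.
rewrite (@crossed_mulEw (u + v) w d (msupp w)) ?msuppD_le //.
rewrite (@crossed_mulEw u w d (msupp w)) ?fsubsetUl //.
rewrite (@crossed_mulEw v w d (msupp w)) ?fsubsetUr //.
rewrite -big_split; apply: eq_bigr => x _ /=.
rewrite -big_split; apply: eq_bigr => y _ /=.
by rewrite mcoeffD !mulrDl monalgUD.
Qed.

Lemma crossed_mulDr : right_distributive crossed_mul +%R.
Proof.
move=> w u v; pose d := (msupp u `|` msupp v)%fset.
rewrite (@crossed_mulEw w (u + v) (msupp w) d) ?msuppD_le //.
rewrite (@crossed_mulEw w u (msupp w) d) ?fsubsetUl //.
rewrite (@crossed_mulEw w v (msupp w) d) ?fsubsetUr //.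
rewrite -big_split; apply: eq_bigr => x _ /=.
rewrite -big_split; apply: eq_bigr => y _ /=.
by rewrite mcoeffD rmorphD mulrDr mulrDl monalgUD.
Qed.

Lemma crossed_mulUU a b x y :
  crossed_mul (mkmalgU x a) (mkmalgU y b) =
  mkmalgU (x * y)%g (a * sigma x b * alpha x y).
Proof.
rewrite (crossed_mulEw (@msuppU_le _ _ x a) (@msuppU_le _ _ y b)).
by rewrite !big_seq_fset1 !mcoeffUU.
Qed.

Lemma crossed_mul0l : left_zero 0 crossed_mul.
Proof.
by move=> u; apply: (addrI (crossed_mul 0 u)); rewrite -crossed_mulDl !addr0.
Qed.

Lemma crossed_mul0r : right_zero 0 crossed_mul.
Proof.
by move=> u; apply: (addrI (crossed_mul u 0)); rewrite -crossed_mulDr !addr0.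
Qed.

Lemma crossed_ind (P : {malg A[G]} -> Prop) :
  P 0 -> (forall u v, P u -> P v -> P (u + v)) ->
  (forall a x, P (mkmalgU x a)) -> forall u, P u.
Proof.
move=> P0 PD PU u; rewrite (monalgEw (fsubset_refl (msupp u))).
by elim/big_ind: _ => // x _; apply: PU.
Qed.

Lemma crossed_sigma1 a : sigma 1%g a = a.
Proof.
apply: (bij_inj (crossed_sigma_bij S 1%g)); rewrite crossed_sigmaM.
by rewrite crossed_alphax1 invr1 mulr1 mul1r mulg1.
Qed.

Lemma crossed_mulA : associative crossed_mul.
Proof.
elim/crossed_ind=> [v w|u1 u2 IH1 IH2 v w|a x]; first by rewrite !crossed_mul0l.
  by rewrite !crossed_mulDl IH1 IH2.
elim/crossed_ind=> [w|v1 v2 IH1 IH2 w|b y].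
- by rewrite !(crossed_mul0l, crossed_mul0r).
- by rewrite !(crossed_mulDl, crossed_mulDr) IH1 IH2.
elim/crossed_ind=> [|w1 w2 IH1 IH2|c z]; first by rewrite !crossed_mul0r.
  by rewrite !crossed_mulDr IH1 IH2.
rewrite !crossed_mulUU mulgA !rmorphM crossed_sigmaM; congr (mkmalgU _ _).
rewrite -!mulrA -crossed_alphaM; do 4!congr (_ * _).
by rewrite mulrA mulVr ?mul1r // crossed_alpha_unit.
Qed.

Lemma crossed_mul1l : left_id crossed_one crossed_mul.
Proof.
elim/crossed_ind=> [|u v IHu IHv|a x]; first by rewrite crossed_mul0r.
  by rewrite crossed_mulDr IHu IHv.
by rewrite crossed_mulUU mul1g mul1r crossed_sigma1 crossed_alpha1x mulr1.
Qed.

Lemma crossed_mul1r : right_id crossed_one crossed_mul.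
Proof.
elim/crossed_ind=> [|u v IHu IHv|a x]; first by rewrite crossed_mul0l.
  by rewrite crossed_mulDl IHu IHv.
by rewrite crossed_mulUU mulg1 rmorph1 crossed_alphax1 !mulr1.
Qed.

Lemma crossed_one_neq0 : crossed_one != 0.
Proof. by rewrite monalgU_eq0 oner_eq0. Qed.

HB.instance Definition _ := GRing.Zmodule_isNzRing.Build (crossed_product S)
  crossed_mulA crossed_mul1l crossed_mul1r crossed_mulDl crossed_mulDr
  crossed_one_neq0.

Definition crossed_base : set (crossed_product S) :=
  [set u : crossed_product S | exists a : A, u = mkmalgU 1%g a]%classic.

End CrossedProductRing.

Arguments crossed_base {A G} S _.

Record two_sided_ideal (R : nzRingType) (I : set R) : Prop := TwoSidedIdeal {
  ideal0 : I 0;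
  idealB : forall u v, I u -> I v -> I (u - v);
  idealMl : forall r u, I u -> I (r * u);
  idealMr : forall r u, I u -> I (u * r)
}.

Definition commutant (R : nzRingType) (B : set R) : set R :=
  [set b | forall a, B a -> a * b = b * a]%classic.

Definition maximal_commutative (R : nzRingType) (B : set R) : Prop :=
  commutant B = B.

(* Main.v *)
Require Import Defs.
From mathcomp Require Import all_boot all_algebra classical_sets.
From mathcomp Require Import finmap monalg.
Import GRing.Theory.
Local Open Scope ring_scope.
Local Open Scope classical_set_scope.

(** If some non-identity degree [g] carried a non-zero coefficient [c] of an
    element commuting with the base ring, comparing coefficients at [g] would
    give [a * c = c * sigma g a] for every scalar [a], so [sigma g] would be the
    identity, the base ring being a domain. As [G] is abelian and the cocycle is
    trivial, the monomial [gbar] is then central ([monomial_central]), hence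
    [1 - gbar] generates the two-sided ideal of its multiples
    ([central_multiples_ideal]), which is non-zero because [g] is not the
    identity.

    That ideal meets the base ring only in [0]: multiplication by [gbar] merely
    moves coefficients around, so it preserves the sum of all coefficients
    ([augmentation_monomial_mul]). This sum therefore vanishes on every multiple
    of [1 - gbar], whereas on a scalar it is the scalar itself. Hence the ideal
    intersection property forces the commutant of the base ring to live in
    degree [1], which is the base ring itself; the converse inclusion is the
    commutativity of the base ring. *)

Definition augmentation {A : nzRingType} {G : choiceType} : {malg A[G]} -> A :=
  mmap idfun (fun=> 1).

Lemma augmentationU {A : nzRingType} {G : choiceType} (x : G) (a : A) :
  augmentation (mkmalgU x a) = a.
Proof. by rewrite /augmentation mmapU mulr1. Qed.

Lemma augmentationD {A : nzRingType} {G : choiceType} (u v : {malg A[G]}) :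
  augmentation (u + v) = augmentation u + augmentation v.
Proof. exact: mmapD. Qed.

Lemma central_multiples_ideal (R : nzRingType) (z : R) :
  (forall r, r * z = z * r) -> two_sided_ideal [set u | exists r, u = z * r].
Proof.
move=> zC; split=> [|_ _ [r ->] [s ->]|s _ [r ->]|s _ [r ->]].
- by exists 0; rewrite mulr0.
- by exists (r - s); rewrite mulrBr.
- by exists (s * r); rewrite mulrA zC mulrA.
- by exists (r * s); rewrite mulrA.
Qed.

Section CrossedProduct.
Variables (A : unitRingType) (G : groupType) (S : crossed_system A G).
Implicit Types (u : crossed_product S) (a : A) (g x : G).

Definition monomial g a : crossed_product S := mkmalgU g a.

Lemma monomialM g h a b :
  monomial g a * monomial h b =
  monomial (g * h)%g (a * crossed_sigma S g b * crossed_alpha S g h).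
Proof. exact: crossed_mulUU. Qed.

(** [crossed_ind] for the ring structure of the crossed product, so that the
    ring lemmas apply to the resulting goals. *)
Lemma crossed_product_ind (P : crossed_product S -> Prop) :
  P 0 -> (forall u v, P u -> P v -> P (u + v)) ->
  (forall a x, P (monomial x a)) -> forall u, P u.
Proof. exact: crossed_ind. Qed.

Lemma mcoeff_scalar_mull a u g : (monomial 1%g a * u)@_g = a * u@_g.
Proof.
elim/crossed_product_ind: u => [|u v IHu IHv|b x].
- by rewrite mulr0 mcoeff0 mulr0.
- by rewrite mulrDr !mcoeffD IHu IHv mulrDr.
rewrite monomialM mul1g crossed_sigma1 crossed_alpha1x mulr1 !mcoeffU.
by rewrite mulrnAr.
Qed.

Lemma mcoeff_scalar_mulr a u g :
  (u * monomial 1%g a)@_g = u@_g * crossed_sigma S g a.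
Proof.
elim/crossed_product_ind: u => [|u v IHu IHv|b x].
- by rewrite mul0r mcoeff0 mul0r.
- by rewrite mulrDl !mcoeffD IHu IHv mulrDl.
rewrite monomialM mulg1 crossed_alphax1 mulr1 !mcoeffU.
by case: eqP => [->|_]; rewrite ?mulr1n ?mulr0n ?mul0r.
Qed.

Hypothesis alpha1 : forall x y : G, crossed_alpha S x y = 1.

Lemma monomial_central g :
    (forall x, (x * g = g * x)%g) -> (forall a, crossed_sigma S g a = a) ->
  forall u, u * monomial g 1 = monomial g 1 * u.
Proof.
move=> gC sg1; elim/crossed_product_ind=> [|u v IHu IHv|a x].
- by rewrite mul0r mulr0.
- by rewrite mulrDl mulrDr IHu IHv.
by rewrite !monomialM !alpha1 sg1 rmorph1 !mulr1 mul1r gC.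
Qed.

Lemma augmentation_monomial_mul g :
    (forall a, crossed_sigma S g a = a) ->
  forall u, augmentation (monomial g 1 * u) = augmentation u.
Proof.
move=> sg1; elim/crossed_product_ind=> [|u v IHu IHv|a x].
- by rewrite mulr0.
- by rewrite mulrDr !augmentationD IHu IHv.
by rewrite monomialM alpha1 sg1 mul1r mulr1 !augmentationU.
Qed.

(** The ideal is generated by the central element [1 - gbar], all of whose
    multiples have augmentation [0]; on the base ring the augmentation is
    injective. *)
Lemma ideal_avoiding_base g :
    g <> 1%g -> (forall x, (x * g = g * x)%g) ->
    (forall a, crossed_sigma S g a = a) ->
  exists I : set (crossed_product S),
    [/\ two_sided_ideal I, I <> [set 0] & I `&` crossed_base S = [set 0]].
Proof.
move=> g_neq1 gC sg1; pose z : crossed_product S := 1 - monomial g 1.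
have idz : two_sided_ideal [set u | exists r, u = z * r].
  apply: central_multiples_ideal => r.
  by rewrite mulrBr mulrBl mulr1 mul1r monomial_central.
exists [set u | exists r, u = z * r]; split=> // [Iz0|].
  have /= z0 : [set 0] z by rewrite -Iz0; exists 1; rewrite mulr1.
  have : z@_g = 0 by rewrite z0 mcoeff0.
  rewrite mcoeffB !mcoeffU eqxx eq_sym (introF eqP g_neq1) sub0r.
  by move/eqP; rewrite oppr_eq0 oner_eq0.
apply/seteqP; split=> [u [[r zr] [a ua]]|_ ->] /=; last first.
  by split; [exact: ideal0 idz | exists 0; rewrite monalgU0].
suff a0 : a = 0 by rewrite ua a0 monalgU0.
rewrite -(augmentationU (G := G) 1%g a) -ua.
(* [u + gbar * r = r], and both [r] and [gbar * r] have the same augmentation *)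
apply: (addIr (augmentation (monomial g 1 * r))).
by rewrite -augmentationD add0r zr mulrBl mul1r subrK augmentation_monomial_mul.
Qed.

End CrossedProduct.

Arguments monomial {A G} S g a.

(** Cancelling a non-zero coefficient in a domain turns commutation with the
    scalars into triviality of the action. *)
Lemma commutant_sigma_id (A : idomainType) (G : groupType)
    (S : crossed_system A G) (b : crossed_product S) (g : G) :
  commutant (crossed_base S) b -> b@_g != 0 ->
  forall a, crossed_sigma S g a = a.
Proof.
move=> bC bg_neq0 a; apply: (mulfI bg_neq0).
have := bC (monomial S 1%g a) (ex_intro _ a erefl).
move/(congr1 (mcoeff g)); rewrite mcoeff_scalar_mull mcoeff_scalar_mulr.
by rewrite [_ * a]mulrC.
Qed.

Theorem theorem5p11 (A : idomainType) (G : groupType)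
    (S : crossed_system A G)
    (G_neq1 : exists g : G, g <> 1%g)
    (G_abelian : forall x y : G, (x * y = y * x)%g)
    (alpha1 : forall x y : G, crossed_alpha S x y = 1) :
  (forall I : set (crossed_product S),
     two_sided_ideal I -> I <> [set 0] ->
     I `&` crossed_base S <> [set 0]) ->
  maximal_commutative (crossed_base S).
Proof.
move=> meet; apply/seteqP; split=> [b bC|_ [a ->] _ [c ->]]; last first.
  rewrite -!/(monomial S _ _) !monomialM !crossed_sigma1 !alpha1 !mulr1.
  by rewrite mulrC.
exists b@_1%g; apply/malgP => g; rewrite mcoeffU.
have [<-|/eqP g_neq1] := eqVneq 1%g g; first by rewrite mulr1n.
rewrite mulr0n; apply/eqP/negPn/negP => bg_neq0.
have [|||I [idI I_neq0 /(meet _ idI I_neq0)//]] :=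
  ideal_avoiding_base _ _ S alpha1 g.
- by move=> g1; apply: g_neq1.
- by move=> x; apply: G_abelian.
- exact: commutant_sigma_id bC bg_neq0.
Qed.
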